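(* Let $(X_0,X_1)$ be a compatible couple and $1\le q<\infty$. If $b\in SV(0,\infty)$ satisfies $$\int_0^\infty t^{-1}b^{q}(t)\,dt<\infty,$$ then the space $X_0$ is dense in $(X_0,X_1)_{0,q,b;K}$.
   Context: A pair $(X_0,X_1)$ of Banach spaces is a compatible couple if there is a Hausdorff topological vector space in which both $X_0$ and $X_1$ are continuously embedded. For $f\in X_0+X_1$ and $t>0$, $$K(f,t;X_0,X_1):=\inf\{\|f_0\|_{X_0}+t\|f_1\|_{X_1}: f=f_0+f_1,\ f_0\in X_0,\ f_1\in X_1\}.$$ For $1\le q<\infty$, $(X_0,X_1)_{0,q,b;K}$ is the set of $f\in X_0+X_1$ with $\|f\|_{0,q,b;K}:=\|t^{-1/q}b(t)K(f,t;X_0,X_1)\|_{q,(0,\infty)}<\infty$, where $\|\cdot\|_{q,(0,\infty)}$ is the $L_q$-norm on $(0,\infty)$; density is with respect to this norm. $SV(0,\infty)$ is the set of slowly varying functions: positive, finite, Lebesgue-measurable functions $b$ on $(0,\infty)$ such that for each $\varepsilon>0$, $t^{\varepsilon}b(t)$ is equivalent to a non-decreasing function on $(0,\infty)$ and $t^{-\varepsilon}b(t)$ is equivalent to a non-increasing function on $(0,\infty)$. (Two non-negative functions are equivalent if each is bounded by a positive constant multiple of the other.) *)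

(* Defs.v *)
From HB Require Import structures.
From mathcomp Require Import all_boot all_order all_algebra.
From mathcomp Require Import all_classical all_reals all_analysis.
From mathcomp Require Import complex.
Import numFieldNormedType.Exports.
Import Order.TTheory GRing.Theory Num.Theory.

Set Implicit Arguments.
Unset Strict Implicit.
Unset Printing Implicit Defensive.

Local Open Scope classical_set_scope.
Local Open Scope ring_scope.

(* Banach spaces are over the reals or over the complex numbers. *)
Variant scalar_kind := RealScalars | ComplexScalars.

Definition scalar_field (R : realType) (k : scalar_kind) : numFieldType :=
  match k with
  | RealScalars => R
  | ComplexScalars => R[i]
  end.

(* The library norm takes its values in the scalar field; a norm in [R[i]] has
   zero imaginary part, so taking the real part loses nothing. *)
Definition scalar_re (R : realType) (k : scalar_kind) :
    scalar_field R k -> R :=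
  match k with
  | RealScalars => fun x => x
  | ComplexScalars => fun z => complex.Re z
  end.

Definition rnorm (R : realType) (k : scalar_kind)
    (X : normedModType (scalar_field R k)) (x : X) : R :=
  scalar_re `|x|.

Section compatible_couple.
Context (R : realType) (k : scalar_kind).
Context (X0 X1 : completeNormedModType (scalar_field R k)).
Context (Z : topologicalLmodType (scalar_field R k)).
Context (e0 : {linear X0 -> Z}) (e1 : {linear X1 -> Z}).

Definition compatible_couple : Prop :=
  [/\ hausdorff_space Z,
      injective e0 /\ continuous e0 &
      injective e1 /\ continuous e1].

Definition sum_space : set Z :=
  [set f | exists (f0 : X0) (f1 : X1), f = e0 f0 + e1 f1].

(* Equal to +oo exactly when [f] is not in [sum_space]. *)
Definition Kfun (f : Z) (t : R) : \bar R :=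
  ereal_inf [set s | exists (f0 : X0) (f1 : X1),
    f = e0 f0 + e1 f1 /\ s = (rnorm f0 + t * rnorm f1)%:E].

Definition Knorm (q : R) (b : R -> R) (f : Z) : \bar R :=
  ('N[@completed_lebesgue_measure R]_(q%:E)
     [(fun t : R => (t `^ (- q^-1) * b t)%R%:E * Kfun f t)
        \_ `]0%R, +oo[])%E.

Definition Kspace (q : R) (b : R -> R) : set Z :=
  [set f | sum_space f /\ (Knorm q b f < +oo)%E].

End compatible_couple.

Definition norm_dense (R : realType) (V : zmodType) (N : V -> \bar R)
    (A Y : set V) : Prop :=
  A `<=` Y /\
  forall f, Y f -> forall eps : R, 0 < eps ->
    exists2 g, A g & (N (f - g)%R < eps%:E)%E.

(* The line with the sigma-algebra of Lebesgue measurable (not only Borel)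
   sets, on which [completed_lebesgue_measure] is defined. *)
Definition lebesgue_line (R : realType) : measurableType _ :=
  caratheodory_type ((@wlength R idfun)^*)%mu.

Definition equivalent_on_pos (R : realType) (f g : R -> R) : Prop :=
  exists c C : R, [/\ 0 < c, 0 < C &
    forall t, 0 < t -> f t <= C * g t /\ g t <= c * f t].

Definition slowly_varying (R : realType) (b : R -> R) : Prop :=
  [/\ forall t, 0 < t -> 0 < b t,
      measurable_fun (`]0, +oo[ : set (lebesgue_line R))
        (b : lebesgue_line R -> R),
      forall eps : R, 0 < eps -> exists g : R -> R,
        {in `]0, +oo[ &, {homo g : x y / x <= y}} /\
        equivalent_on_pos (fun t => t `^ eps * b t) g &
      forall eps : R, 0 < eps -> exists g : R -> R,
        {in `]0, +oo[ &, {homo g : x y /~ x <= y}} /\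
        equivalent_on_pos (fun t => t `^ (- eps) * b t) g].

(* Main.v *)
Require Import Defs.
From HB Require Import structures.
From mathcomp Require Import all_boot all_order all_algebra.
From mathcomp Require Import all_classical all_reals all_analysis.
From mathcomp Require Import measurable_realfun complex lra.
Import numFieldNormedType.Exports.
Import Order.TTheory GRing.Theory Num.Theory.

Set Implicit Arguments.
Unset Strict Implicit.
Unset Printing Implicit Defensive.

Local Open Scope classical_set_scope.
Local Open Scope ring_scope.

(** Write [w t = b t ^ q / t], so that the norm of [f] is the [L_q(w dt)] norm
    of [K(f, .)].  Every [x] in [X_0] has [K(x, t) <= |x|], so integrability of
    [w] puts [X_0] inside the space ([range_e0_Kspace]).

    For density, split [f = f0 + f1] with [|f0| + s |f1| <= 2 K(f, s)] and
    approximate [f] by [f0].  The error [f1] satisfies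
    [K(f1, t) <= K(f, t) + |f0|] and [K(f1, t) <= t |f1|].  As [K(f, .)]
    increases and [K(f, t) / t] decreases, the first bound for [t >= s] and the
    second for [t <= s] give [K(f1, t) <= 3 K(f, t)] for every [t], whatever
    [s] is; the second bound also gives [K(f1, t) <= 2 t K(f, s) / s]
    ([Kreal_approx]).  So dominated convergence finishes the proof
    ([wpow_cvg0]) once [K(f, s) / s] takes arbitrarily small values.

    If it did not, then [K(f, t) >= eta t] for some [eta > 0].  Slow variation
    of [b] keeps [t b t] away from [0] on [[1, +oo[], hence
    [w t * K(f, t) ^ q >= c / t] there, and [1 / t] is not integrable at
    infinity: the norm of [f] would be infinite
    ([integrable_wpow_small_slope]). *)

(** * The real-valued norm *)

Lemma scalar_re_le (R : realType) (k : scalar_kind) (x y : scalar_field R k) :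
  x <= y -> scalar_re x <= scalar_re y.
Proof. by case: k x y => //= x y; rewrite lecE => /andP[]. Qed.

Lemma scalar_reD (R : realType) (k : scalar_kind) (x y : scalar_field R k) :
  scalar_re (x + y) = scalar_re x + scalar_re y.
Proof. by case: k x y => //= -[? ?] [? ?]. Qed.

Lemma scalar_re0 (R : realType) (k : scalar_kind) :
  scalar_re (0 : scalar_field R k) = 0.
Proof. by case: k. Qed.

Section rnorm.
Context (R : realType) (k : scalar_kind).
Context (X : normedModType (scalar_field R k)).
Implicit Types x y : X.

Lemma rnorm_ge0 x : 0 <= rnorm x.
Proof. by rewrite -(scalar_re0 R k) scalar_re_le. Qed.

Lemma rnorm0 : rnorm (0 : X) = 0.
Proof. by rewrite /rnorm normr0 scalar_re0. Qed.

Lemma rnormN x : rnorm (- x) = rnorm x.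
Proof. by rewrite /rnorm normrN. Qed.

Lemma rnormD x y : rnorm (x + y) <= rnorm x + rnorm y.
Proof. by rewrite /rnorm -scalar_reD scalar_re_le ?ler_normD. Qed.

End rnorm.

(** * The K-functional *)

Section Kreal.
Context (R : realType) (k : scalar_kind).
Context (X0 X1 : completeNormedModType (scalar_field R k)).
Context (Z : topologicalLmodType (scalar_field R k)).
Context (e0 : {linear X0 -> Z}) (e1 : {linear X1 -> Z}).
Implicit Types (f : Z) (s t : R).

(** The K-functional as a real number.  The value [0] for [t <= 0] makes it
    nondecreasing on the whole line, where monotone functions are Borel. *)
Definition Kreal f t : R :=
  if 0 < t then fine (Kfun e0 e1 f t) else 0.

Lemma Kfun_fin_num f t : sum_space e0 e1 f -> 0 < t ->
  Kfun e0 e1 f t \is a fin_num.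
Proof.
move=> [f0 [f1 ff]] t0; rewrite ge0_fin_numE.
  apply: le_lt_trans (ltry (rnorm f0 + t * rnorm f1)).
  by apply: ereal_inf_lbound; exists f0, f1.
apply: le_ereal_inf_tmp => _ [g0 [g1 [_ ->]]].
by rewrite lee_fin addr_ge0 ?mulr_ge0 ?rnorm_ge0 ?ltW.
Qed.

Lemma KrealE f t : sum_space e0 e1 f -> 0 < t ->
  Kfun e0 e1 f t = (Kreal f t)%:E.
Proof. by move=> sf t0; rewrite /Kreal t0 fineK// Kfun_fin_num. Qed.

Lemma Kreal_le (f0 : X0) (f1 : X1) t : 0 < t ->
  Kreal (e0 f0 + e1 f1) t <= rnorm f0 + t * rnorm f1.
Proof.
move=> t0; have sf : sum_space e0 e1 (e0 f0 + e1 f1) by exists f0, f1.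
rewrite -lee_fin -KrealE//.
by apply: ereal_inf_lbound; exists f0, f1.
Qed.

Lemma le_Kreal f t (c : R) : sum_space e0 e1 f -> 0 < t ->
  (forall (f0 : X0) (f1 : X1), f = e0 f0 + e1 f1 -> c <= rnorm f0 + t * rnorm f1) ->
  c <= Kreal f t.
Proof.
move=> sf t0 H; rewrite -lee_fin -KrealE//.
by apply: le_ereal_inf_tmp => _ [f0 [f1 [ff ->]]]; rewrite lee_fin H.
Qed.

Lemma Kreal_adherent f t (c : R) : sum_space e0 e1 f -> 0 < t ->
  Kreal f t < c ->
  exists (f0 : X0) (f1 : X1), f = e0 f0 + e1 f1 /\ rnorm f0 + t * rnorm f1 < c.
Proof.
move=> sf t0; rewrite -lte_fin -KrealE// => /ereal_inf_lt[_ [f0 [f1 [ff ->]]]].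
by rewrite lte_fin; exists f0, f1.
Qed.

Lemma Kreal_ge0 f t : sum_space e0 e1 f -> 0 <= Kreal f t.
Proof.
move=> sf; case: (ltP 0 t) => t0; last by rewrite /Kreal ltNge t0.
by apply: le_Kreal => // f0 f1 _; rewrite addr_ge0 ?mulr_ge0 ?rnorm_ge0 ?ltW.
Qed.

Lemma Kreal_nondecreasing f : sum_space e0 e1 f ->
  {homo Kreal f : s t / s <= t}.
Proof.
move=> sf s t st; case: (ltP 0 s) => s0; last first.
  by rewrite [leLHS]/Kreal ltNge s0 Kreal_ge0.
have t0 := lt_le_trans s0 st.
apply: le_Kreal => // f0 f1 ->.
by rewrite (le_trans (Kreal_le _ _ s0))// lerD2l ler_wpM2r ?rnorm_ge0.
Qed.

(** Each competitor [rnorm f0 + t * rnorm f1] has this property in [t], since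
    [s / t <= 1]; infima inherit it. *)
Lemma Kreal_quasiconcave f s t : sum_space e0 e1 f -> 0 < s -> s <= t ->
  s * Kreal f t <= t * Kreal f s.
Proof.
move=> sf s0 st; have t0 := lt_le_trans s0 st.
rewrite -ler_pdivrMl// mulrA; apply: le_Kreal => // f0 f1 ff.
have st1 : t^-1 * s <= 1 by rewrite mulrC ler_pdivrMr ?mul1r.
have ts0 : 0 <= t^-1 * s by rewrite mulr_ge0 ?invr_ge0 ?ltW.
rewrite ff; apply: le_trans (ler_wpM2l ts0 (Kreal_le f0 f1 t0)) _.
rewrite mulrDr [t^-1 * s * (t * _)]mulrA (mulrAC t^-1 s t) mulVf ?gt_eqF//.
rewrite mul1r lerD2r.
by rewrite ler_piMl// rnorm_ge0.
Qed.

Lemma sum_space_e0 (x : X0) : sum_space e0 e1 (e0 x).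
Proof. by exists x, 0; rewrite linear0 addr0. Qed.

Lemma sum_space_sub_e0 f (x : X0) :
  sum_space e0 e1 f -> sum_space e0 e1 (f - e0 x).
Proof. by move=> [f0 [f1 ->]]; exists (f0 - x), f1; rewrite linearB addrAC. Qed.

Lemma Kreal_sub_e0 f (x : X0) t : sum_space e0 e1 f -> 0 < t ->
  Kreal (f - e0 x) t <= Kreal f t + rnorm x.
Proof.
move=> sf t0; rewrite -lerBlDr; apply: le_Kreal => // f0 f1 ->.
rewrite lerBlDr addrAC -linearB (le_trans (Kreal_le _ _ t0))//.
by rewrite addrAC lerD2r (le_trans (rnormD _ _))// rnormN.
Qed.

(** Unless [Kreal f s = 0], the element [x] is the first component of a
    decomposition of [f] that is optimal for [s] up to a factor 2.  The bound by [3 * Kreal f t] provides an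
    integrable majorant independent of [eta]; the bound by [2 * eta * t] gives
    pointwise convergence as [eta] tends to 0. *)
Lemma Kreal_approx f (eta : R) : sum_space e0 e1 f -> 0 < eta ->
  (exists2 s, 0 < s & Kreal f s <= s * eta) ->
  exists x : X0, forall t, 0 < t ->
    Kreal (f - e0 x) t <= 3 * Kreal f t /\
    Kreal (f - e0 x) t <= 2 * eta * t.
Proof.
move=> sf eta0 [s s0 Ks].
(* If [K(f, s) = 0] the infimum need not be attained, so no decomposition is
   within a factor 2 of it; but then [K(f, .)] vanishes and [x = 0] will do. *)
have [Ks0|Ks0] := leP (Kreal f s) 0.
  exists 0 => t t0; rewrite linear0 subr0.
  suff -> : Kreal f t = 0 by rewrite mulr0 !mulr_ge0// ltW.
  apply/eqP; rewrite eq_le Kreal_ge0// andbT.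
  have [ts|/ltW st] := leP t s; first exact: le_trans (Kreal_nondecreasing sf ts) Ks0.
  rewrite -(pmulr_rle0 _ s0) (le_trans (Kreal_quasiconcave sf s0 st))//.
  by rewrite pmulr_rle0.
have : Kreal f s < 2 * Kreal f s by lra.
move=> /(Kreal_adherent sf s0)[f0 [f1 [ff Hs]]].
have f0_ge0 := rnorm_ge0 f0; have f1_ge0 := rnorm_ge0 f1.
have sf1_ge0 : 0 <= s * rnorm f1 by rewrite mulr_ge0// ltW.
exists f0 => t t0.
have Kf1 : Kreal (f - e0 f0) t <= t * rnorm f1.
  have := Kreal_le 0 f1 t0.
  by rewrite linear0 add0r rnorm0 add0r ff addrC addKr.
have Hf1 : s * (t * rnorm f1) <= t * (2 * Kreal f s).
  by rewrite mulrCA ler_pM2l//; lra.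
split.
  have [ts|/ltW st] := leP t s.
    have := Kreal_quasiconcave sf t0 ts => H.
    have Kt0 := Kreal_ge0 t sf.
    apply: (le_trans Kf1); rewrite -(ler_pM2l s0) (le_trans Hf1)//.
    have : 0 <= s * Kreal f t by rewrite mulr_ge0// ltW.
    lra.
  have := Kreal_nondecreasing sf st.
  by have := Kreal_sub_e0 f0 sf t0; lra.
apply: (le_trans Kf1); rewrite -(ler_pM2l s0) (le_trans Hf1)//.
have := ler_wpM2l (ltW t0) Ks; lra.
Qed.

End Kreal.

(** * Lebesgue measurability on the line *)

Section lebesgue_line.
Context (R : realType).
Local Notation mu := (@completed_lebesgue_measure R).
Local Notation L := (lebesgue_line R).

Lemma measurable_lebesgue_line (A : set R) :
  measurable (A : set (measurableTypeR R)) -> measurable (A : set L).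
Proof. exact: sub_caratheodory. Qed.

Lemma measurable_fun_lebesgue_line (f : R -> R) (D : set R) :
  measurable_fun (D : set (measurableTypeR R)) f ->
  measurable (D : set (measurableTypeR R)) ->
  measurable_fun (D : set L) (f : L -> R).
Proof. by move=> mf mD _ Y mY; apply: measurable_lebesgue_line; exact: mf. Qed.

Lemma measurable_pos : measurable (`]0, +oo[ : set L).
Proof. apply: measurable_lebesgue_line; exact: measurable_itv. Qed.

(** The normalised indicators of [`]a, 2 a]] all have integral 1 and lie below
    [2 / t], yet tend to 0 uniformly as [a] grows; dominated convergence would
    contradict this if [1 / t] were integrable. *)
Lemma inv_not_integrable :
  ~ mu.-integrable (`[1, +oo[ : set L) (fun t : L => (t^-1)%:E).
Proof.
pose D := [set` `[1%R, +oo[] : set L.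
move=> intV; have mD : measurable D.
  apply: measurable_lebesgue_line; exact: measurable_itv.
pose a n : R := n.+1%:R.
have a0 n : 0 < a n by rewrite ltr0n.
have a1 n : 1 <= a n by rewrite ler1n.
pose I n := [set` `]a n, 2 * a n]] : set L.
have mI n : measurable (I n).
    apply: measurable_lebesgue_line; exact: measurable_itv.
have muI n : mu (I n) = (a n)%:E.
  transitivity (@lebesgue_measure R `]a n, 2 * a n]) => //.
  rewrite lebesgue_measure_itv/= lte_fin ltr_pMl// ltr1n -EFinB.
  by rewrite mulr2n mulrDl mul1r addrK.
pose h n (t : L) : \bar R := ((a n)^-1 * \1_(I n) t)%:E.
have intI n : (\int[mu]_(t in D) h n t = 1)%E.
  under eq_integral do rewrite /h EFinM.
  rewrite ge0_integralZl_EFin//; last 2 first.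
  - exact/measurable_EFinP/measurable_indic.
  - by rewrite invr_ge0 ltW.
  rewrite integral_indic// setIidl; last first.
    move=> t; rewrite /I /D /= !in_itv/= => /andP[at_ _]; rewrite andbT.
    by rewrite (le_trans (a1 n))// ltW.
  rewrite [X in (_ * X)%E](muI n) -EFinM mulVf// gt_eqF//.
have := @dominated_convergence _ L R mu _ mD h (cst 0%E)
  (fun t => (2%:E * (t^-1)%:E)%E).
case => //.
- by move=> n; apply/measurable_EFinP/measurable_funM => //; exact: measurable_indic.
- apply: aeW => t _; apply/fine_cvgP; split; first exact: nearW.
  apply: (@squeeze_cvgr _ _ _ _ (cst 0) (fun n => (a n)^-1)).
  + apply: nearW => n; have an0 : 0 <= (a n)^-1 by rewrite invr_ge0 ltW.
    rewrite /h /= indicE; apply/andP; split; first by rewrite mulr_ge0.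
    by rewrite ler_piMr//; case: (_ \in _).
  + exact: cvg_cst.
  + exact: cvg_harmonic.
- exact: integrableZl.
- apply: aeW => t n; rewrite /D /= in_itv/= andbT => t1.
  have t0 : 0 < t := lt_le_trans ltr01 t1.
  rewrite /h lee_fin indicE; case: (boolP (t \in I n)) => [|_].
    rewrite inE /I /= in_itv/= => /andP[_ tn].
    rewrite mulr1 ger0_norm; last by rewrite invr_ge0 ltW.
    by rewrite ler_pdivlMr// mulrC ler_pdivrMr.
  by rewrite mulr0 normr0; apply: mulr_ge0; rewrite ?invr_ge0 ?ltW.
move=> _ _; rewrite integral0.
have -> : [sequence (\int[mu]_(t in D) h n t)%E]_n = cst 1%E.
  by apply/funext => n; exact: intI.
move/(cvg_unique (@ereal_hausdorff R) (cvg_cst _))/eqP.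
by rewrite eqe oner_eq0.
Qed.

End lebesgue_line.

(** * Weighted integrals with a slowly varying weight *)

Section weighted.
Context (R : realType) (q : R) (b : R -> R).
Hypotheses (q1 : 1 <= q) (hb : slowly_varying b).
Local Notation mu := (@completed_lebesgue_measure R).
Local Notation L := (lebesgue_line R).
Local Notation pos := ([set` `]0%R, +oo[] : set L).

(** The integrand whose integral over [`]0, +oo[] is the [q]-th power of the
    interpolation norm, for [k] the K-functional. *)
Definition wpow (k : R -> R) (t : R) : R := t^-1 * b t `^ q * k t `^ q.

Let q0 : 0 < q. Proof. exact: lt_le_trans ltr01 q1. Qed.

Let posP (t : R) : pos t -> 0 < t.
Proof. by rewrite /= in_itv/= andbT. Qed.

Lemma wpow_ge0 k t : 0 < t -> 0 <= wpow k t.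
Proof. by move=> t0; rewrite !mulr_ge0 ?powR_ge0// invr_ge0 ltW. Qed.

Lemma measurable_wpow (k : R -> R) :
  measurable_fun pos (k : L -> R) -> measurable_fun pos (wpow k : L -> R).
Proof.
move=> mk; have [_ mb _ _] := hb.
apply: measurable_funM; last exact: measurableT_comp (measurable_powR q) mk.
apply: measurable_funM; last exact: measurableT_comp (measurable_powR q) mb.
apply: (@eq_measurable_fun _ _ L _ _ (fun t : L => (t : R) `^ (-1))).
  by move=> t; rewrite inE => /posP t0; rewrite powR_inv1// ltW.
apply: measurable_fun_lebesgue_line; last exact: measurable_itv.
exact: measurable_funTS (measurable_powR _).
Qed.

(** Otherwise [k t > t * eta] everywhere, and [wpow k t >= (m * eta) ^ q / t]
    for [t >= 1], where [m] bounds [t * b t] from below. *)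
Lemma integrable_wpow_small_slope (k : R -> R) (eta : R) :
  mu.-integrable pos (fun t : L => (wpow k t)%:E) -> 0 < eta ->
  exists2 s, 0 < s & k s <= s * eta.
Proof.
move=> ik eta0; apply: contrapT => nk.
have {nk}ket s : 0 < s -> s * eta < k s.
  by move=> s0; rewrite ltNge; apply/negP => ks; apply: nk; exists s.
(* Slow variation with exponent 1 makes [t * b t] comparable to a nondecreasing
   function [g], so it stays above [g 1 / c] on [[1, +oo[]. *)
have [b0 _ /(_ _ ltr01)[g [ndg [c [C [c0 C0 gb]]]]] _] := hb.
pose m := g 1 / c.
have g1_gt0 : 0 < g 1.
  have [h _] := gb 1 ltr01.
  by rewrite -(pmulr_rgt0 _ C0) (lt_le_trans _ h)// powR1 mul1r b0.
have m0 : 0 < m by rewrite divr_gt0.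
have mb t : 1 <= t -> m <= t * b t.
  move=> t1; have t0 := lt_le_trans ltr01 t1; rewrite ler_pdivrMr// mulrC.
  have [_] := gb t t0; rewrite powRr1 ?(ltW t0)//; apply: le_trans.
  by apply: ndg => //; rewrite in_itv/= andbT.
pose D := [set` `[1%R, +oo[] : set L.
have mD : measurable D by apply: measurable_lebesgue_line; exact: measurable_itv.
pose M := (m * eta) `^ q.
have M0 : 0 < M by apply: powR_gt0; exact: mulr_gt0.
apply: (@inv_not_integrable R).
apply: (@le_integrable _ L _ mu _ mD _ (fun t => (M^-1)%:E * (wpow k t)%:E)%E).
- apply/measurable_EFinP.
  apply: (@eq_measurable_fun _ _ L _ _ (fun t : L => (t : R) `^ (-1))).
    move=> t; rewrite inE /D/= in_itv/= andbT => t1.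
    by rewrite powR_inv1// (le_trans ler01).
  apply: measurable_fun_lebesgue_line; last exact: measurable_itv.
  exact: measurable_funTS (measurable_powR _).
- move=> t; rewrite /D/= in_itv/= andbT => t1; have t0 := lt_le_trans ltr01 t1.
  have V0 : 0 <= t^-1 by rewrite invr_ge0 ltW.
  have W0 : 0 <= M^-1 * wpow k t by rewrite mulr_ge0 ?wpow_ge0// invr_ge0 ltW.
  rewrite lee_fin !ger0_norm//.
  rewrite ler_pdivlMl// /wpow -mulrA mulrC ler_pM2l ?invr_gt0//.
  have bt0 := ltW (b0 _ t0); have kt0 : 0 <= k t.
    by apply: le_trans (ltW (ket _ t0)); rewrite mulr_ge0 ?ltW.
  rewrite -powRM//; apply: ge0_ler_powR; rewrite ?nnegrE ?(ltW q0)//.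
  + by rewrite mulr_ge0 ?ltW.
  + by rewrite mulr_ge0.
  rewrite (le_trans (ler_wpM2r (ltW eta0) (mb t t1)))//.
  by rewrite mulrAC mulrC ler_wpM2l// ltW// ket.
- apply: integrableZl => //; apply: integrableS ik => //; first exact: measurable_pos.
  by move=> t; rewrite /D/= !in_itv/= !andbT; exact: lt_le_trans.
Qed.

(** Dominated convergence: the bound by [c * k t] gives the majorant
    [c ^ q * wpow k], the bound by [d * t / (n + 1)] the pointwise limit 0. *)
Lemma wpow_cvg0 (k : R -> R) (kn : nat -> R -> R) (c d : R) :
  0 <= c -> (forall t, 0 < t -> 0 <= k t) ->
  mu.-integrable pos (fun t : L => (wpow k t)%:E) ->
  (forall n, measurable_fun pos (kn n : L -> R)) ->
  (forall n t, 0 < t -> [/\ 0 <= kn n t, kn n t <= c * k t &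
    kn n t <= d * n.+1%:R^-1 * t]) ->
  (\int[mu]_(t in pos) (wpow (kn n) t)%:E)%E @[n --> \oo] --> 0%E.
Proof.
move=> c0 k0 ik mkn hkn.
have := @dominated_convergence _ L R mu _ (@measurable_pos R)
  (fun n t => (wpow (kn n) t)%:E) (cst 0%E)
  (fun t => ((c `^ q)%:E * (wpow k t)%:E)%E).
rewrite integral0; case => //.
- by move=> n; apply/measurable_EFinP/measurable_wpow.
- apply: aeW => t /posP t0; apply/fine_cvgP; split; first exact: nearW.
  have d0t : 0 <= d * t.
    by have [kn0 _] := hkn 0%N t t0; rewrite invr1 mulr1; exact: le_trans.
  have n1 n : n.+1%:R^-1 <= 1 :> R by rewrite invf_le1 ?ler1n ?ltr0n.
  pose w := t^-1 * b t `^ q * (d * t) `^ q.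
  have w0 : 0 <= t^-1 * b t `^ q by rewrite mulr_ge0 ?powR_ge0// invr_ge0 ltW.
  apply: (@squeeze_cvgr _ _ _ _ (cst 0) (fun n => w * n.+1%:R^-1)).
  + apply: nearW => n; rewrite /= wpow_ge0//= /w /wpow -[leRHS]mulrA ler_wpM2l//.
    have [kn0 _ knd] := hkn n t t0.
    apply: (@le_trans _ _ ((d * n.+1%:R^-1 * t) `^ q)).
      by apply: ge0_ler_powR; rewrite ?nnegrE ?(ltW q0)// (le_trans kn0).
    (* Since [q >= 1], the power [(n + 1) ^- q] is at most [(n + 1)^-1]. *)
    rewrite mulrAC [X in X <= _]powRM ?invr_ge0// ler_wpM2l ?powR_ge0//.
    by apply: ge1r_powR => //; rewrite invr_gt0 ltr0n n1.
  + exact: cvg_cst.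
  + rewrite -[X in _ --> X](mulr0 w); apply: cvgMr; exact: cvg_harmonic.
- apply: integrableZl => //; exact: measurable_pos.
- apply: aeW => t n /posP t0; have [kn0 knc _] := hkn n t t0.
  rewrite lee_fin ger0_norm ?wpow_ge0// /wpow mulrCA ler_wpM2l//.
    by rewrite mulr_ge0 ?powR_ge0// invr_ge0 ltW.
  rewrite -powRM ?k0//; apply: ge0_ler_powR => //; rewrite ?nnegrE ?(ltW q0)//.
  by rewrite mulr_ge0// k0.
Qed.

End weighted.

(** * The interpolation norm *)

Section Knorm.
Context (R : realType) (k : scalar_kind).
Context (X0 X1 : completeNormedModType (scalar_field R k)).
Context (Z : topologicalLmodType (scalar_field R k)).
Context (e0 : {linear X0 -> Z}) (e1 : {linear X1 -> Z}).
Context (q : R) (b : R -> R).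
Hypotheses (q1 : 1 <= q) (hb : slowly_varying b).
Local Notation mu := (@completed_lebesgue_measure R).
Local Notation L := (lebesgue_line R).
Local Notation pos := ([set` `]0%R, +oo[] : set L).
Local Notation K := (Kreal e0 e1).

Let q0 : 0 < q. Proof. exact: lt_le_trans ltr01 q1. Qed.

Lemma measurable_Kreal f : sum_space e0 e1 f ->
  measurable_fun pos (K f : L -> R).
Proof.
move=> sf; apply: measurable_fun_lebesgue_line; last exact: measurable_itv.
by apply: nondecreasing_measurable => // s t; exact: Kreal_nondecreasing.
Qed.

Lemma KnormE f : sum_space e0 e1 f ->
  Knorm e0 e1 q b f =
  poweR (\int[mu]_(t in pos) (wpow q b (K f) t)%:E)%E q^-1.
Proof.
move=> sf; rewrite /Knorm unlock; congr (poweR _ _).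
rewrite [RHS]integral_mkcond; apply: eq_integral => t _.
rewrite !patchE; case: ifPn => [|_]; last by rewrite abse0 poweR0r ?gt_eqF.
rewrite inE /= in_itv/= andbT => t0.
have b0 : 0 <= b t by case: hb => /(_ _ t0)/ltW.
rewrite KrealE// -EFinM abse_EFin poweR_EFin ger0_norm; last first.
  by rewrite !mulr_ge0 ?powR_ge0// Kreal_ge0.
rewrite !powRM ?mulr_ge0 ?powR_ge0 ?Kreal_ge0// /wpow -powRrM mulNr mulVf ?gt_eqF//.
by rewrite powR_inv1// ltW.
Qed.

Lemma integrable_wpow_Kreal f : Kspace e0 e1 q b f ->
  mu.-integrable pos (fun t : L => (wpow q b (K f) t)%:E).
Proof.
move=> [sf]; rewrite KnormE// => /lty_poweRy H.
apply/integrableP; split.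
  apply/measurable_EFinP; apply: measurable_wpow => //.
  exact: measurable_Kreal.
rewrite (eq_integral (fun t : L => (wpow q b (K f) t)%:E)).
  by apply: H; rewrite invr_eq0 gt_eqF.
move=> t; rewrite inE /= in_itv/= andbT => t0.
by rewrite ger0_norm// wpow_ge0.
Qed.

Lemma range_e0_Kspace :
  (\int[mu]_(t in pos) (t^-1 * b t `^ q)%:E < +oo)%E ->
  range e0 `<=` Kspace e0 e1 q b.
Proof.
move=> fin _ [x _ <-]; have sx := sum_space_e0 e0 e1 x; split => //.
rewrite KnormE//; apply: poweR_lty.
pose c := rnorm x `^ q.
have cst_mul t : (wpow q b (cst (rnorm x)) t)%:E = (c%:E * (t^-1 * b t `^ q)%:E)%E.
  by rewrite -EFinM mulrC.
apply: (@le_lt_trans _ _ (\int[mu]_(t in pos) (wpow q b (cst (rnorm x)) t)%:E)%E).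
  apply: ge0_le_integral.
  - exact: measurable_pos.
  - by move=> t; rewrite /= in_itv/= andbT lee_fin => /wpow_ge0.
  - apply/measurable_EFinP; apply: measurable_wpow => //.
    exact: measurable_Kreal.
  - by apply/measurable_EFinP; apply: measurable_wpow.
  - move=> t; rewrite /= in_itv/= andbT => t0; rewrite lee_fin ler_wpM2l//.
      by rewrite mulr_ge0 ?powR_ge0// invr_ge0 ltW.
    apply: ge0_ler_powR; rewrite ?nnegrE ?(ltW q0) ?Kreal_ge0 ?rnorm_ge0//.
    have := Kreal_le e0 e1 x 0 t0.
    by rewrite linear0 addr0 rnorm0 mulr0 addr0.
under eq_integral do rewrite cst_mul.
rewrite ge0_integralZl_EFin ?powR_ge0//.
- by rewrite lte_mul_pinfty ?lee_fin ?powR_ge0.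
- exact: measurable_pos.
- move=> t; rewrite /= in_itv/= andbT => t0.
  by rewrite lee_fin mulr_ge0 ?powR_ge0// invr_ge0 ltW.
- apply/measurable_EFinP.
  have := @measurable_wpow R q b hb (cst 1) (measurable_cst _).
  by apply: eq_measurable_fun => t _; rewrite /wpow powR1 mulr1.
Qed.

End Knorm.

Theorem theorem1p12 (R : realType) (k : scalar_kind)
    (X0 X1 : completeNormedModType (scalar_field R k))
    (Z : topologicalLmodType (scalar_field R k))
    (e0 : {linear X0 -> Z}) (e1 : {linear X1 -> Z})
    (hX : compatible_couple e0 e1)
    (q : R) (hq : 1 <= q)
    (b : R -> R) (hb : slowly_varying b)
    (hint : (\int[@completed_lebesgue_measure R]_(t in `]0%R, +oo[)
               (t^-1 * b t `^ q)%R%:E < +oo)%E) :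
  norm_dense (Knorm e0 e1 q b) (range e0) (Kspace e0 e1 q b).
Proof.
have q0 : 0 < q := lt_le_trans ltr01 hq.
split; first exact: range_e0_Kspace.
move=> f Kf eps eps0; have [sf _] := Kf.
have intK := integrable_wpow_Kreal hq hb Kf.
have /choice[x xP] (n : nat) : exists x : X0, forall t, 0 < t ->
    Kreal e0 e1 (f - e0 x) t <= 3 * Kreal e0 e1 f t /\
    Kreal e0 e1 (f - e0 x) t <= 2 * n.+1%:R^-1 * t.
  apply: Kreal_approx => //.
  exact: integrable_wpow_small_slope hq hb _ _ intK _.
have ss n : sum_space e0 e1 (f - e0 (x n)) by exact: sum_space_sub_e0.
have int0 : (\int[@completed_lebesgue_measure R]_(t in [set` `]0%R, +oo[])
    (wpow q b (Kreal e0 e1 (f - e0 (x n))) t)%:E)%E @[n --> \oo] --> 0%E.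
  apply: (wpow_cvg0 hq hb (c := 3) (d := 2) _ _ intK) => //.
  - by move=> t _; exact: Kreal_ge0.
  - by move=> n; exact: measurable_Kreal.
  - by move=> n t t0; have [? ?] := xP n t t0; split => //; exact: Kreal_ge0.
have de0 : 0 < eps / 2 by rewrite divr_gt0.
have eq0 : (0 < ((eps / 2) `^ q)%:E :> \bar R)%E by rewrite lte_fin powR_gt0.
have [n _ /(_ n (leqnn n))/= small] := int0 _ (open_ereal_lt' eq0).
exists (e0 (x n)); first by exists (x n).
rewrite KnormE//; apply: (@le_lt_trans _ _ (eps / 2)%:E); last first.
  by rewrite lte_fin ltr_pdivrMr// ltr_pMr// ltr1n.
have -> : (eps / 2)%:E = poweR ((eps / 2) `^ q)%:E q^-1.
  by rewrite poweR_EFin -powRrM mulfV ?gt_eqF// powRr1// ltW.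
apply: gt0_ler_poweR; last exact: ltW.
- by rewrite invr_ge0 ltW.
- rewrite in_itv/= leey andbT; apply: integral_ge0 => t.
  by rewrite /= in_itv/= andbT lee_fin => /wpow_ge0.
- by rewrite in_itv/= leey andbT ltW.
Qed.
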